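(* For every integer $d\ge 1$ there is a constant $C_d>0$, depending only on $d$, such that the following holds. Let $K$ be any field, let $V_1,\ldots,V_d$ be finite-dimensional $K$-vector spaces, and let $t\in V_1\otimes\cdots\otimes V_d$ be a tensor whose border partition rank is $\underline{\mathrm{prk}}(t)=r<\infty$. If $K$ is infinite, then $\mathrm{prk}_K(t)\le C_d\, r^{d-1}$. If $K$ is finite, then $\mathrm{prk}_K(t)\le C_d\, r^{d-1}\log(r+1)$. In particular, $\mathrm{prk}_K(t)$ is also bounded by a polynomial in $\mathrm{prk}_{\overline{K}}(t)$: for every $d$ there is a polynomial $P_d$ in one variable such that $\mathrm{prk}_K(t)\le P_d(\mathrm{prk}_{\overline{K}}(t))$ for all fields $K$, all finite-dimensional $K$-vector spaces $V_1,\ldots,V_d$ and all tensors $t\in V_1\otimes\cdots\otimes V_d$ with $\mathrm{prk}_{\overline{K}}(t)<\infty$, where $\overline{K}$ is an algebraic closure of $K$.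
   Context: Tensor products are over $K$. Write $[d]=\{1,\ldots,d\}$ and, for $I\subseteq[d]$, $V_I:=\bigotimes_{i\in I}V_i$ and $I^c:=[d]\setminus I$; identify $V_I\otimes V_{I^c}$ with $V_1\otimes\cdots\otimes V_d$ canonically. The partition rank $\mathrm{prk}_K(t)$ of $t\in V_1\otimes\cdots\otimes V_d$ is the minimal $r\ge 0$ in any expression $t=\sum_{i=1}^r a_i\otimes b_i$ where each $a_i\in V_{I_i}$ and $b_i\in V_{I_i^c}$ for some proper nonempty subset $I_i\subset[d]$ (and $\infty$ if there is no such expression). For a field extension $L/K$, $\mathrm{prk}_L(t)$ is the partition rank over $L$ of $t$ viewed in $(L\otimes_K V_1)\otimes_L\cdots\otimes_L(L\otimes_K V_d)$. The border partition rank $\underline{\mathrm{prk}}(t)$ is defined as follows. Choose bases so that $V_j=K^{n_j}$, and for $I\subseteq[d]$ let $\mathcal{T}_I$ be the affine space over $\mathbb{Z}$ with coordinates indexed by $\prod_{i\in I}\{1,\ldots,n_i\}$, so that $\mathcal{T}_I(K)=V_I$. Then $\underline{\mathrm{prk}}(t)$ is the minimal $r\ge 0$ such that there exist proper nonempty subsets $I_1,\ldots,I_r\subset[d]$ for which $t$ is a $K$-point of the Zariski closure of the image of the morphism over $\mathbb{Z}$ $$\prod_{i=1}^r(\mathcal{T}_{I_i}\times\mathcal{T}_{I_i^c})\to\mathcal{T}_{[d]},\quad ((a_i,b_i))_i\mapsto\sum_{i=1}^r a_i\otimes b_i$$ (and $\infty$ if there is no such $r$). The logarithm is to base $2$. 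*)

(* Defs.v *)
From HB Require Import structures.
From mathcomp Require Import all_boot all_order all_algebra.
From mathcomp Require Import mpoly.
From mathcomp Require Import reals exp.

Set Implicit Arguments.
Unset Strict Implicit.
Unset Printing Implicit Defensive.

Import GRing.Theory.
Local Open Scope ring_scope.

(* Bases are fixed throughout: V_j = K^(n j), and V_J, the tensor product of  *)
(* the V_j for j : J, is the space of K-valued functions on the product of    *)
(* the index sets 'I_(n j). The case n j = 0 is allowed.                      *)

Definition multi_index (J : finType) (n : J -> nat) : finType :=
  {dffun forall j : J, 'I_(n j)}.

Definition tensor (K : fieldType) (J : finType) (n : J -> nat) : zmodType :=
  {ffun multi_index n -> K}.

Definition sub_dims (J : finType) (n : J -> nat) (I : {set J}) :
    {j : J | j \in I} -> nat :=
  fun j => n (val j).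

Definition restrict (J : finType) (n : J -> nat) (I : {set J})
    (x : multi_index n) : multi_index (sub_dims n (I := I)) :=
  [ffun j : {j : J | j \in I} => x (val j)].

(* a (x) b, for a in V_I and b in V_(I^c), read in V_J = V_I (x) V_(I^c) *)
Definition tensor_mul (K : fieldType) (J : finType) (n : J -> nat)
    (I : {set J}) (a : tensor K (sub_dims n (I := I)))
    (b : tensor K (sub_dims n (I := ~: I))) : tensor K n :=
  [ffun x => a (restrict I x) * b (restrict (~: I) x)].

Definition map_tensor (K L : fieldType) (iota : {rmorphism K -> L})
    (J : finType) (n : J -> nat) (t : tensor K n) : tensor L n :=
  [ffun x => iota (t x)].

Definition proper_nonempty (J : finType) (I : {set J}) : bool :=
  (I != set0) && (I \proper [set: J]).

(* Ranks with values in nat + {infinity} are given by their graphs: the rank  *)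
(* is infinite when it is related to no natural number.                       *)
Definition is_minimum (P : nat -> Prop) (r : nat) : Prop :=
  P r /\ forall s : nat, P s -> (r <= s)%N.

Definition partition_sum (K : fieldType) (d : nat) (n : 'I_d -> nat)
    (t : tensor K n) (r : nat) : Prop :=
  exists (I : 'I_r -> {set 'I_d})
         (a : forall i : 'I_r, tensor K (sub_dims n (I := I i)))
         (b : forall i : 'I_r, tensor K (sub_dims n (I := ~: I i))),
    (forall i, proper_nonempty (I i)) /\
    t = \sum_(i < r) tensor_mul (a i) (b i).

Definition partition_rank (K : fieldType) (d : nat) (n : 'I_d -> nat)
    (t : tensor K n) (r : nat) : Prop :=
  is_minimum (partition_sum t) r.

(* Points of Spec A are prime ideals of A, and sets of points are predicates  *)
(* on {pred A} that are only meant to be applied to prime ideals.             *)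

Definition prime_ideal (A : comNzRingType) (p : {pred A}) : Prop :=
  idealr_closed p /\ prime_idealr_closed p.

Definition zero_locus (A : comNzRingType) (F : A -> Prop) (p : {pred A}) :
    Prop :=
  forall f, F f -> f \in p.

Definition zariski_closure (A : comNzRingType) (Z : {pred A} -> Prop)
    (p : {pred A}) : Prop :=
  forall F : A -> Prop,
    (forall q, Z q -> zero_locus F q) -> zero_locus F p.

(* the image of the morphism Spec B -> Spec A induced by phi : A -> B *)
Definition spec_image (A B : comNzRingType) (phi : A -> B) (q : {pred A}) :
    Prop :=
  exists2 p : {pred B}, prime_ideal p & q =i [pred f | phi f \in p].

(* The coordinate ring of the affine space over Z with coordinates indexed by *)
(* X; multinomials only have variables in some 'I_m, hence the enumeration.   *)
Definition Zpoly (X : finType) : comNzRingType := {mpoly int[#|X|]}.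

Definition coordinate (X : finType) (x : X) : Zpoly X := 'X_(enum_rank x).

(* The ring morphism Z[Y] -> Z[X] sending the coordinate y to g y, that is,   *)
(* the comorphism of the morphism A^X -> A^Y with components g.               *)
Definition comorphism (X Y : finType) (g : Y -> Zpoly X) (f : Zpoly Y) :
    Zpoly X :=
  f \mPo [tuple g (enum_val i) | i < #|Y|].

(* the point of A^X underlying the K-point t : Spec K -> A^X, namely the      *)
(* kernel of evaluation at t                                                  *)
Definition field_point (K : fieldType) (X : finType) (t : X -> K) :
    {pred Zpoly X} :=
  [pred f : Zpoly X |
    mmap (intr : int -> K) (fun i => t (enum_val i)) f == 0].

(* coordinates of the product over i of T_(I i) x T_((I i)^c) *)
Definition source_coord (d : nat) (n : 'I_d -> nat) (r : nat)
    (I : 'I_r -> {set 'I_d}) : finType :=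
  {i : 'I_r & (multi_index (sub_dims n (I := I i))
               + multi_index (sub_dims n (I := ~: I i)))%type}.

Definition source_left (d : nat) (n : 'I_d -> nat) (r : nat)
    (I : 'I_r -> {set 'I_d}) (i : 'I_r)
    (x : multi_index (sub_dims n (I := I i))) : source_coord n I :=
  existT _ i (inl x).

Definition source_right (d : nat) (n : 'I_d -> nat) (r : nat)
    (I : 'I_r -> {set 'I_d}) (i : 'I_r)
    (x : multi_index (sub_dims n (I := ~: I i))) : source_coord n I :=
  existT _ i (inr x).

Definition universal_sum (d : nat) (n : 'I_d -> nat) (r : nat)
    (I : 'I_r -> {set 'I_d})
    (x : multi_index n) : Zpoly (source_coord n I) :=
  \sum_(i < r) coordinate (source_left (restrict (I i) x))
             * coordinate (source_right (restrict (~: I i) x)).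

Definition border_partition_sum (K : fieldType) (d : nat) (n : 'I_d -> nat)
    (t : tensor K n) (r : nat) : Prop :=
  exists I : 'I_r -> {set 'I_d},
    (forall i, proper_nonempty (I i)) /\
    zariski_closure (spec_image (comorphism (universal_sum I (n := n))))
      (field_point t).

Definition border_partition_rank (K : fieldType) (d : nat) (n : 'I_d -> nat)
    (t : tensor K n) (r : nat) : Prop :=
  is_minimum (border_partition_sum t) r.

Definition algebraic_closure (K L : fieldType) (iota : {rmorphism K -> L}) :
    Prop :=
  GRing.closed_field_axiom L /\ forall x : L, algebraicOver iota x.

Definition log2 (R : realType) (x : R) : R := ln x / ln 2.

(* Main.v *)
(** Put m = 18 r and D = 2 r m^(d-1), so that m^d = 9 D, while the source of
    the parametrisation of sums of r products in (K^m)^(tensor d) has at most D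
    coordinates. There are at least 9^D squarefree monomials of degree D in the
    m^d tensor entries, and they pull back to combinations of at most 8^D
    monomials of degree 2D. Hence some integral combination f of squarefree
    monomials, nonzero over every field, vanishes on all such sums, and so on
    phi(t) whenever t has border partition rank at most r and phi is a tuple of
    linear maps V_i -> L^m, for L an extension of K.

    Let some iterated partial derivative g of f vanish at phi(t) for all phi,
    and let its derivative in the entry alpha not vanish at phi(t) for some phi.
    Replace phi_i by phi_i + s_i (e_(alpha_i) (x) xi_i). When L has more than D
    elements, the coefficient of s_1 ... s_d in g(phi(t)) is zero. By the chain
    rule in s_1 this coefficient is a nonzero multiple of t(xi_1, ..., xi_d)
    plus, for each proper J containing 1 and each of the m^(d-|J|) tensor
    positions beta with beta_J = alpha_J, a function of xi_J times a function of
    xi_(J^c). So the partition rank of t over L is at most 2^d m^(d-1).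

    For finite K, take L to be a tower of quadratic extensions of degree
    O(log r) over K; writing products in a K-basis of L multiplies the partition
    rank by at most [L : K]. *)

Require Import Defs.
From mathcomp Require Import all_boot all_order all_algebra.
From mathcomp Require Import mpoly.
From mathcomp Require Import classical_sets cardinality reals exp.
From mathcomp Require Import boolp fieldext finset.

Import Order.TTheory GRing.Theory Num.Theory.
Local Open Scope ring_scope.

Set Implicit Arguments.
Unset Strict Implicit.
Unset Printing Implicit Defensive.

(** * Splitting multi-indices along a subset *)

(** Elements of V_I are handled as functions of full multi-indices, so that factors for different
    [I] share one type. *)
Definition local_on (J : finType) (n : J -> nat) (T : Type) (I : {set J})
    (f : multi_index n -> T) : Prop :=
  forall x y : multi_index n, (forall j, j \in I -> x j = y j) -> f x = f y.

Lemma setC_notin (J : finType) (I : {set J}) j : ~ (j \in I) -> j \in ~: I.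
Proof. by rewrite inE => /negP. Qed.

(** Inverse of the pair of restrictions to [I] and [~: I]; matching on [decP] supplies the
    membership proof that the index type demands. *)
Definition glue (J : finType) (n : J -> nat) (I : {set J})
    (y : multi_index (sub_dims n (I := I)))
    (z : multi_index (sub_dims n (I := ~: I))) : multi_index n :=
  [ffun j => match decP (@idP (j \in I)) with
             | left h => y (exist _ j h)
             | right h => z (exist _ j (setC_notin h))
             end].

Lemma glue_left (J : finType) (n : J -> nat) (I : {set J}) y z j (h : j \in I) :
  @glue J n I y z j = y (exist _ j h).
Proof.
rewrite ffunE; case: decP => h'; last by case: (h' h).
by rewrite (bool_irrelevance h h').
Qed.

Lemma glue_right (J : finType) (n : J -> nat) (I : {set J}) y z j (h : j \in ~: I) :
  @glue J n I y z j = z (exist _ j h).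
Proof.
rewrite ffunE; case: decP => h'; first by have := h; rewrite inE h'.
by rewrite (bool_irrelevance h (setC_notin h')).
Qed.

Lemma restrict_glueL (J : finType) (n : J -> nat) (I : {set J}) y z : restrict I (@glue J n I y z) = y.
Proof. by apply/ffunP => -[j h]; rewrite ffunE glue_left. Qed.

Lemma restrict_glueR (J : finType) (n : J -> nat) (I : {set J}) y z : restrict (~: I) (@glue J n I y z) = z.
Proof. by apply/ffunP => -[j h]; rewrite ffunE glue_right. Qed.

Lemma glue_restrict (J : finType) (n : J -> nat) (I : {set J}) (x : multi_index n) :
  glue (restrict I x) (restrict (~: I) x) = x :> multi_index n.
Proof.
apply/ffunP => j; have [h|h] := boolP (j \in I).
  by rewrite (glue_left _ _ h) ffunE.
by rewrite (glue_right _ _ (setC_notin (negP h))) ffunE.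
Qed.

Lemma sum_glue (R : nmodType) (J : finType) (n : J -> nat) (I : {set J}) (F : multi_index n -> R) :
  \sum_x F x =
  \sum_(y : multi_index (sub_dims n (I := I)))
     \sum_(z : multi_index (sub_dims n (I := ~: I))) F (glue y z).
Proof.
rewrite pair_big /= (reindex (fun p : multi_index (sub_dims n (I := I)) *
  multi_index (sub_dims n (I := ~: I)) => glue p.1 p.2)) //.
exists (fun x => (restrict I x, restrict (~: I) x)).
  by move=> [y z] _; rewrite restrict_glueL restrict_glueR.
by move=> x _ /=; rewrite glue_restrict.
Qed.

Lemma prod_glue (R : comNzRingType) (J : finType) (n : J -> nat) (I : {set J})
    (F : forall j : J, 'I_(n j) -> R) y z :
  \prod_j F j (@glue J n I y z j) =
  (\prod_(j : {j | j \in I}) F (val j) (y j)) *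
  (\prod_(j : {j | j \in ~: I}) F (val j) (z j)).
Proof.
rewrite (bigID (mem I)) /=; congr (_ * _).
  rewrite [LHS]big_sub /=; apply: eq_bigr => -[j h] _ /=.
  by rewrite (glue_left _ _ h).
rewrite (eq_bigl (mem (~: I))); last by move=> j; rewrite !inE.
rewrite [LHS]big_sub /=; apply: eq_bigr => -[j h] _ /=.
by rewrite (glue_right _ _ h).
Qed.

Lemma local_extend (J : finType) (n : J -> nat) (T : Type) (I : {set J})
    (f : multi_index n -> T) (x0 x : multi_index n) :
  local_on I f -> f (glue (restrict I x) (restrict (~: I) x0)) = f x.
Proof. by move=> lf; apply: lf => j h; rewrite (glue_left _ _ h) ffunE. Qed.

Lemma local_extendC (J : finType) (n : J -> nat) (T : Type) (I : {set J})
    (f : multi_index n -> T) (x0 x : multi_index n) :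
  local_on (~: I) f -> f (glue (restrict I x0) (restrict (~: I) x)) = f x.
Proof. by move=> lf; apply: lf => j h; rewrite (glue_right _ _ h) ffunE. Qed.

(** Padding with a fixed multi-index turns local functions into tensors on V_I and its complement,
    and enumerating [Q] orders the terms. *)
Lemma partition_sum_local (K : fieldType) d (n : 'I_d -> nat) (t : tensor K n)
    (Q : finType) (I : Q -> {set 'I_d}) (a b : Q -> multi_index n -> K) :
  (forall q, proper_nonempty (I q)) ->
  (forall q, local_on (I q) (a q)) -> (forall q, local_on (~: I q) (b q)) ->
  (forall x, t x = \sum_q a q x * b q x) ->
  partition_sum t #|Q|.
Proof.
move=> hI ha hb ht; pose e i : Q := enum_val (A := Q) i.
have [x0 _|n0] := pickP (@predT (multi_index n)).
  exists (fun i => I (e i)).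
  exists (fun i => [ffun y => a (e i) (glue y (restrict _ x0))]).
  exists (fun i => [ffun z => b (e i) (glue (restrict _ x0) z)]).
  split=> [i|]; first exact: hI.
  apply/ffunP => x; rewrite ht sum_ffunE (big_enum_val (A := Q)) /=.
  apply: eq_bigr => i _; rewrite !ffunE.
  by rewrite local_extend ?local_extendC.
(* There are no multi-indices when some [n j] is 0; the tensor space is then zero. *)
exists (fun i => I (e i)), (fun i => 0), (fun i => 0); split=> [i|].
  exact: hI.
by apply/ffunP => x; have := n0 x.
Qed.

(** * Interpolation at zero *)

(** Lagrange weights at 0, which exist because the Vandermonde matrix of distinct nodes is
    invertible. *)
Lemma interpolation_at_0 (L : fieldType) D (p : 'I_D -> L) :
  injective p ->
  exists u : 'I_D -> L, forall q : {poly L}, (size q <= D)%N ->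
    \sum_j u j * q.[p j] = q.[0].
Proof.
move=> injp; pose V := Vandermonde D (\row_j p j).
have uV : V \in unitmx.
  rewrite unitmxE unitfE det_Vandermonde; apply/prodf_neq0 => i _.
  apply/prodf_neq0 => j ltij; rewrite !mxE subr_eq0; apply/eqP => /injp eqij.
  by rewrite eqij ltnn in ltij.
(* A solution u of V u = e satisfies: the sum of u_j p_j^k is 1 for k = 0 and 0 for 0 < k < D. *)
pose e : 'cV[L]_D := \col_k (val k == 0)%:R.
exists (fun j => (invmx V *m e) j 0) => q szq.
under eq_bigr do rewrite (horner_coef_wide _ szq) mulr_sumr.
rewrite exchange_big /=.
transitivity (\sum_(k < D) q`_k * (V *m (invmx V *m e)) k 0).
  apply: eq_bigr => k _; rewrite [in RHS]mxE mulr_sumr; apply: eq_bigr => j _.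
  rewrite mulrCA; congr (_ * _); rewrite mulrC; congr (_ * _).
  by rewrite !mxE.
rewrite mulKVmx //; under eq_bigr do rewrite mxE.
case: D {p injp V uV e} q szq => [|D] q szq.
  by rewrite big_ord0 horner_coef0 nth_default.
rewrite big_ord_recl big1 => [|i _]; last by rewrite mulr0.
by rewrite mulr1 addr0 horner_coef0.
Qed.

Definition upd (T : Type) (d : nat) (s : {ffun 'I_d -> T}) (i : 'I_d) (c : T) :
  {ffun 'I_d -> T} := [ffun k => if k == i then c else s k].

Definition zero_on (L : fieldType) (d : nat) (J : {set 'I_d})
    (s : {ffun 'I_d -> L}) : {ffun 'I_d -> L} :=
  [ffun i => if i \in J then 0 else s i].

(** Degree below [D] in each variable separately, as interpolation acts on one variable at a
    time. *)
Definition poly_fun (L : fieldType) (d D : nat) (h : {ffun 'I_d -> L} -> L) :=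
  forall i s, exists2 q : {poly L}, (size q <= D)%N &
    forall c, h (upd s i c) = q.[c].

Lemma poly_fun_zero_on (L : fieldType) (d D : nat) J (h : {ffun 'I_d -> L} -> L) :
  poly_fun D h -> poly_fun D (h \o zero_on J).
Proof.
move=> ph i s; have [q szq hq] := ph i (zero_on J s).
have [iJ|iJ] := boolP (i \in J).
  (* A constant has size at most 1, which fits unless [D = 0]; in that case [h] itself vanishes. *)
  exists (if D is 0 then 0 else (h (zero_on J s))%:P).
    by case: (D) => [|D']; rewrite ?size_poly0 // (leq_trans (size_polyC_leq1 _)).
  move=> c; have E : zero_on J (upd s i c) = zero_on J s.
    by apply/ffunP => k; rewrite !ffunE; case: eqP => // ->; rewrite iJ.
  rewrite /= E; case: D ph szq => [|D'] ph szq; last by rewrite hornerC.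
  move: szq; rewrite leqn0 size_poly_eq0 => /eqP q0.
  have := hq (zero_on J s i); rewrite q0 !horner0 => <-; congr h.
  by apply/ffunP => k; rewrite !ffunE; case: eqP => // ->.
exists q => // c; rewrite -hq /=; congr h; apply/ffunP => k; rewrite !ffunE.
by case: (k =P i) => // ->; rewrite (negPf iJ).
Qed.

(* For each [i] in [J], adding an independent sample of weight [u] at [i]     *)
(* makes the two sums exchange under the involution swapping both samples.    *)
Lemma sum_weights_zero_on (L : fieldType) (d D : nat) (p u : 'I_D -> L)
    (W : 'I_d -> 'I_D -> L) (J : {set 'I_d}) (h : {ffun 'I_d -> L} -> L) :
  (0 < D)%N ->
  (forall q : {poly L}, (size q <= D)%N -> \sum_j u j * q.[p j] = q.[0]) ->
  poly_fun D h -> (forall i j, i \in J -> W i j = u j) ->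
  \sum_(sg : {ffun 'I_d -> 'I_D})
      (\prod_i W i (sg i)) * h [ffun i => p (sg i)] =
  \sum_(sg : {ffun 'I_d -> 'I_D})
      (\prod_i W i (sg i)) * h (zero_on J [ffun i => p (sg i)]).
Proof.
move=> D0 hu; elim: {J}_.+1 {-2}J (ltnSn #|J|) h => // N IH J; rewrite ltnS => leJ h ph hW.
have [->|[i iJ]] := set_0Vmem J.
  apply: eq_bigr => sg _; congr (_ * h _).
  by apply/ffunP => k; rewrite [in RHS]ffunE inE.
have u1 : \sum_j u j = 1.
  have := hu 1; rewrite size_poly1 hornerC => /(_ D0) <-.
  by apply: eq_bigr => j _; rewrite hornerC mulr1.
(* This zeroes all of [J] but [i]; it remains to zero the single coordinate [i] in [h']. *)
rewrite (IH (J :\ i)) //; first last.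
- by move=> k j; rewrite inE => /andP[_]; apply: hW.
- by rewrite (cardsD1 i J) iJ in leJ.
have {ph} := poly_fun_zero_on (J :\ i) ph.
set h' := h \o _ => ph.
have -> : \sum_(sg : {ffun 'I_d -> 'I_D})
      (\prod_i W i (sg i)) * h (zero_on J [ffun i => p (sg i)]) =
   \sum_(sg : {ffun 'I_d -> 'I_D}) \sum_j
      (\prod_i W i (sg i)) * u j * h' [ffun k => p (upd sg i j k)].
  apply: eq_bigr => sg _.
  have [q szq hq] := ph i [ffun k => p (sg k)].
  have <- : h' (upd [ffun k => p (sg k)] i 0) = h (zero_on J [ffun i => p (sg i)]).
    congr h; apply/ffunP => k; rewrite !ffunE !inE.
    by case: eqP => //= ->; rewrite iJ.
  rewrite hq -hu // mulr_sumr; apply: eq_bigr => j _; rewrite -hq mulrA.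
  by congr (_ * h' _); apply/ffunP => k; rewrite !ffunE; case: eqP.
rewrite pair_big /=.
pose sw (x : {ffun 'I_d -> 'I_D} * 'I_D) := (upd x.1 i x.2, x.1 i).
have swK : involutive sw.
  move=> [sg j]; rewrite /sw /= !ffunE eqxx; congr (_, _).
  by apply/ffunP => k; rewrite !ffunE; case: eqP => // ->.
rewrite [RHS](reindex_inj (inv_inj swK)) /=.
rewrite -(pair_big xpredT xpredT (fun sg j => (\prod_i0 W i0 (upd sg i j i0)) *
   u (sg i) * h' [ffun k => p (upd (upd sg i j) i (sg i) k)])) /=.
apply: eq_bigr => sg _.
transitivity (\sum_j u j * ((\prod_i0 W i0 (sg i0)) * h' [ffun i0 => p (sg i0)])).
  by rewrite -mulr_suml u1 mul1r.
apply: eq_bigr => j _; rewrite mulrA; congr (_ * h' _); last first.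
  by apply/ffunP => k; rewrite !ffunE; case: eqP => // ->.
rewrite (bigD1 i) //= [in RHS](bigD1 i) //= !hW // ffunE eqxx mulrCA [RHS]mulrC.
congr (_ * (_ * _)); by apply: eq_bigr => k /negPf ki; rewrite ffunE ki.
Qed.

(** * Multiaffine functions and their derivatives *)

(** The iterated partial derivative along [A] of the combination of squarefree monomials with
    coefficients [v], evaluated at [y]. *)
Definition multiaffine (R : comNzRingType) (X : finType) (v : {set X} -> R)
    (A : {set X}) (y : X -> R) : R :=
  \sum_(S : {set X} | A \subset S) v S * \prod_(b in S :\: A) y b.

(** Entry [b] of the image of [t] under the tensor product of the linear maps with matrices
    [phi i]. *)
Definition contract (R : comNzRingType) (d m : nat) (n : 'I_d -> nat)
    (phi : forall i, 'I_m -> 'I_(n i) -> R) (t : multi_index n -> R)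
    (b : multi_index (fun _ : 'I_d => m)) : R :=
  \sum_z t z * \prod_i phi i (b i) (z i).

(** The Leibniz rule at 0. *)
Lemma coef1_prod_affine (R : comNzRingType) (X : eqType) (r : seq X)
    (a b : X -> R) : uniq r ->
  (\prod_(x <- r) ((a x)%:P + b x *: 'X))`_1 =
  \sum_(x <- r) b x * \prod_(y <- r | y != x) a y.
Proof.
have c0 s : (\prod_(x <- s) ((a x)%:P + b x *: 'X))`_0 = \prod_(x <- s) a x.
  rewrite -horner_coef0 horner_prod; apply: eq_bigr => x _.
  by rewrite !hornerE ?mulr0 ?addr0.
elim: r => [|x r IH] /=; first by rewrite !big_nil coef1.
move=> /andP[xr ur]; rewrite !big_cons mulrDl coefD coefCM IH //.
rewrite -scalerAl coefZ coefXM /= c0 addrC eqxx /=; congr (_ * _ + _).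
  by rewrite big_seq_cond [RHS]big_seq_cond; apply: eq_bigl => y;
     case: eqP => [->|]; rewrite ?(negPf xr) // andbT.
rewrite mulr_sumr [LHS]big_seq [RHS]big_seq; apply: eq_bigr => y yr.
rewrite big_cons; case: eqP => [e|_] /=; first by rewrite e yr in xr.
by rewrite mulrCA.
Qed.

Lemma size_prod_affine (R : idomainType) (X : finType) (B : {set X})
    (a b : X -> R) :
  (size (\prod_(x in B) ((a x)%:P + b x *: 'X))%R <= #|B|.+1)%N.
Proof.
apply: leq_trans (size_poly_prod_leq _ _) _.
have : (\sum_(x in B) size ((a x)%:P + b x *: 'X)%R <= #|B| * 2)%N.
  rewrite -sum_nat_const; apply: leq_sum => x _.
  apply: leq_trans (size_polyD _ _) _; rewrite geq_max.
  rewrite (leq_trans (size_polyC_leq1 _)) //=.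
  by apply: leq_trans (size_scale_leq _ _) _; rewrite size_polyX.
move=> h; rewrite leq_subLR addnS ltnS (leq_trans h) //.
by rewrite muln2 addnn.
Qed.

Definition affine_line (R : comNzRingType) (X : finType) (v : {set X} -> R)
    (A : {set X}) (a b : X -> R) : {poly R} :=
  \sum_(S : {set X} | A \subset S)
    v S *: \prod_(x in S :\: A) ((a x)%:P + b x *: 'X).

Lemma horner_affine_line (R : comNzRingType) (X : finType) (v : {set X} -> R)
    (A : {set X}) (a b : X -> R) c :
  (affine_line v A a b).[c] = multiaffine v A (fun x => a x + c * b x).
Proof.
rewrite /affine_line horner_sum; apply: eq_bigr => S _.
rewrite hornerZ horner_prod; congr (_ * _); apply: eq_bigr => x _.
by rewrite !hornerE mulrC.
Qed.

Lemma size_affine_line (R : idomainType) (X : finType) (v : {set X} -> R)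
    (A : {set X}) (a b : X -> R) D :
  (forall S, v S != 0 -> #|S| = D) ->
  (size (affine_line v A a b) <= (D - #|A|).+1)%N.
Proof.
move=> hv; apply: (big_ind (fun p : {poly R} => size p <= (D - #|A|).+1)%N).
- by rewrite size_poly0.
- by move=> p q hp hq; rewrite (leq_trans (size_polyD _ _)) // geq_max hp.
move=> S AS; have [->|nz] := eqVneq (v S) 0; first by rewrite scale0r size_poly0.
apply: leq_trans (size_scale_leq _ _) _.
apply: leq_trans (size_prod_affine _ _ _) _.
by rewrite ltnS cardsD (setIidPr AS) (hv _ nz).
Qed.

(** The chain rule at 0. Directions in [A] do not contribute, as the monomials are squarefree. *)
Lemma coef1_affine_line (R : comNzRingType) (X : finType) (v : {set X} -> R)
    (A : {set X}) (a b : X -> R) :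
  (affine_line v A a b)`_1 =
  \sum_(x | x \notin A) multiaffine v (x |: A) a * b x.
Proof.
rewrite coef_sum.
transitivity (\sum_(S : {set X} | A \subset S) \sum_(x in S :\: A)
   v S * \prod_(y in S :\: (x |: A)) a y * b x).
  apply: eq_bigr => S AS; rewrite coefZ -big_enum coef1_prod_affine ?enum_uniq //.
  rewrite big_enum mulr_sumr; apply: eq_bigr => x xS.
  rewrite -mulrA; congr (_ * _); rewrite mulrC big_enum_cond; congr (_ * _).
  by apply: eq_bigl => y; rewrite !inE negb_or; case: (y == x); rewrite ?andbF ?andbT.
rewrite (exchange_big_dep (fun x => x \notin A)) /=; last first.
  by move=> S x _; rewrite !inE => /andP[].
apply: eq_bigr => x xA; rewrite /multiaffine mulr_suml; apply: eq_bigl => S.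
by rewrite subUset sub1set !inE xA andbC.
Qed.

(* Deriving along a whole squarefree monomial yields a nonzero constant, in   *)
(* any characteristic.                                                        *)
Lemma last_vanishing_derivative (R : comNzRingType) (X : finType) (T : Type)
    (v : {set X} -> R) (y : T -> X -> R) D S0 :
  (forall S, v S != 0 -> #|S| = D) -> v S0 != 0 -> T ->
  (forall f, multiaffine v set0 (y f) = 0) ->
  exists (A : {set X}) x, [/\ x \notin A, forall f, multiaffine v A (y f) = 0 &
    exists f, multiaffine v (x |: A) (y f) <> 0].
Proof.
move=> hv nz f0 h0.
(* Enlarge [A] inside [S0], one element at a time, while the derivative still vanishes at every
   point. *)
suff: forall N (A : {set X}), (#|S0 :\: A| < N)%N -> A \subset S0 ->
  (forall f, multiaffine v A (y f) = 0) ->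
  exists (A : {set X}) x, [/\ x \notin A, forall f, multiaffine v A (y f) = 0 &
    exists f, multiaffine v (x |: A) (y f) <> 0].
  by move=> /(_ #|S0 :\: set0|.+1 set0); apply=> //; rewrite sub0set.
elim=> // N IH A; rewrite ltnS => lN AS hA.
have [E|[x]] := set_0Vmem (S0 :\: A).
  (* The process cannot reach [S0]: all monomials have degree [D], so the derivative along [S0] is
     the constant [v S0]. *)
  have {E AS} E : A = S0 by apply/eqP; rewrite eqEsubset AS -setD_eq0 E /=.
  have := hA f0; rewrite /multiaffine E (bigD1 S0) //= setDv big_set0 mulr1.
  rewrite big1 ?addr0 => [e|S /andP[sS nS]]; first by rewrite e eqxx in nz.
  have [->|nzS] := eqVneq (v S) 0; first by rewrite mul0r.
  case/negP: nS; rewrite eq_sym eqEcard sS (hv _ nzS) (hv _ nz) leqnn //.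
rewrite inE => /andP[xA xS].
have [h|h] := pselect (forall f, multiaffine v (x |: A) (y f) = 0); last first.
  by exists A, x; split=> //; apply/existsNP.
apply: (IH (x |: A)) => //; last by rewrite subUset sub1set xS.
apply: leq_trans lN; apply: proper_card; apply/properP; split.
  by apply: setDS; apply: subsetUr.
by exists x; rewrite !inE ?eqxx ?xA.
Qed.

(** * The partition rank decomposition *)

Lemma card_multi_index (J : finType) (n : J -> nat) :
  #|multi_index n| = (\prod_j n j)%N.
Proof. by rewrite card_dep_ffun foldrE big_map big_enum /=; under eq_bigr do rewrite card_ord. Qed.

Lemma card_multi_index_sub (d m : nat) (I : {set 'I_d}) :
  #|multi_index (sub_dims (fun _ : 'I_d => m) (I := I))| = (m ^ #|I|)%N.
Proof. by rewrite card_multi_index prod_nat_const card_sig. Qed.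

Section Core.

Variables (L : fieldType) (d m : nat) (n : 'I_d -> nat).
Variable t : multi_index n -> L.
Variable phi : forall i, 'I_m -> 'I_(n i) -> L.
Variable alpha : multi_index (fun _ : 'I_d => m).

Definition unit_entry (x : multi_index n) (i : 'I_d) (b : 'I_m) (z : 'I_(n i)) : L :=
  ((b == alpha i) && (z == x i))%:R.

(* The choice xi_i = dual basis vector of index x_i. *)
Definition perturb (x : multi_index n) (s : {ffun 'I_d -> L}) (i : 'I_d)
    (b : 'I_m) (z : 'I_(n i)) : L :=
  phi b z + s i * unit_entry x b z.

(** The coefficient of [s i] in entry [b] of the perturbed contraction, which is affine in [s i]. *)
Definition slope (x : multi_index n) (i : 'I_d) (s : {ffun 'I_d -> L})
    (b : multi_index (fun _ : 'I_d => m)) : L :=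
  \sum_z t z * (unit_entry x (b i) (z i) *
     \prod_(k | k != i) perturb x s (b k) (z k)).

Lemma contract_perturb_upd x s i c b :
  contract (perturb x (upd s i c)) t b =
  contract (perturb x (upd s i 0)) t b + c * slope x i s b.
Proof.
rewrite /contract /slope mulr_sumr -big_split /=; apply: eq_bigr => z _.
have E e : \prod_(k | k != i) perturb x (upd s i e) (b k) (z k) =
           \prod_(k | k != i) perturb x s (b k) (z k).
  by apply: eq_bigr => k /negPf ki; rewrite /perturb ffunE ki.
rewrite (bigD1 i) //= E [X in _ = t z * X + _](bigD1 i) //= E.
rewrite {1 3}/perturb !ffunE eqxx mul0r addr0.
rewrite mulrDl mulrDr; congr (_ + _); rewrite -!mulrA; exact: mulrCA.
Qed.

(** The coefficient of the product of the [s i], for [i] in [J], in entry [b] of the perturbed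
    contraction. *)
Definition flattening (J : {set 'I_d}) (b : multi_index (fun _ : 'I_d => m))
    (x : multi_index n) : L :=
  \sum_z t z * \prod_i (if i \in J then unit_entry x (b i) (z i)
                        else phi (b i) (z i)).

Lemma slope_expand x i0 s b :
  slope x i0 s b =
  \sum_(J : {set 'I_d} | i0 \in J)
     (\prod_(i in J) if i == i0 then 1 else s i) * flattening J b x.
Proof.
rewrite /slope /flattening; under [RHS]eq_bigr do rewrite mulr_sumr.
rewrite [RHS]exchange_big /=; apply: eq_bigr => z _.
under [RHS]eq_bigr do rewrite mulrCA.
rewrite -mulr_sumr; congr (_ * _).
(* Putting 0 in place of [phi] at [i0] kills the subsets that miss [i0] when the product is
   expanded. *)
transitivity (\prod_i ((if i == i0 then 1 else s i) * unit_entry x (b i) (z i) +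
  (if i == i0 then 0 else phi (b i) (z i)))).
  rewrite [RHS](bigD1 i0) //= eqxx mul1r addr0; congr (_ * _).
  by apply: eq_bigr => k /negPf ki; rewrite ki addrC.
rewrite bigA_distr (bigID (fun J : {set 'I_d} => i0 \in J)) /= addrC big1 ?add0r.
  apply: eq_bigr => J iJ; rewrite [X in _ = X * _]big_mkcond -big_split /=.
  apply: eq_bigr => i _; case: ifP => // iJ'; rewrite ?mul1r //.
  by case: eqP => // e; rewrite e iJ in iJ'.
by move=> J /negPf iJ; rewrite (bigD1 i0) //= iJ eqxx mul0r.
Qed.

Lemma local_flattening J b : local_on J (flattening J b).
Proof.
move=> x y exy; apply: eq_bigr => z _; congr (_ * _); apply: eq_bigr => i _.
by case: ifP => // iJ; rewrite /unit_entry exy.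
Qed.

(** This limits the entries [b] that count for a given [J], and leaves only [alpha] when [J] is
    full. *)
Lemma flattening_eq0 (J : {set 'I_d}) (b : multi_index (fun _ : 'I_d => m)) x i :
  i \in J -> b i != alpha i -> flattening J b x = 0.
Proof.
move=> iJ /negPf bi; apply: big1 => z _; rewrite (bigD1 i) //= iJ.
by rewrite /unit_entry bi mul0r mulr0.
Qed.

Lemma flattening_setT x : flattening setT alpha x = t x.
Proof.
rewrite /flattening (bigD1 x) //= [X in _ * X]big1 => [|i _]; last first.
  by rewrite inE /unit_entry !eqxx.
rewrite mulr1 big1 ?addr0 // => z zx.
have /existsP[i zi] : [exists i, z i != x i].
  rewrite -negb_forall; apply: contra zx => /forallP e.
  by apply/eqP/ffunP => i; apply/eqP/e.
by rewrite (bigD1 i) //= inE /unit_entry (negPf zi) andbF mul0r mulr0.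
Qed.

Variables (D : nat) (v : {set multi_index (fun _ : 'I_d => m)} -> L).
Variable A : {set multi_index (fun _ : 'I_d => m)}.
Variables (p : 'I_D -> L) (i0 : 'I_d).

Hypothesis hv : forall S, v S != 0 -> #|S| = D.
Hypothesis hp0 : forall j, p j != 0.
Hypothesis hp : injective p.
Hypothesis D_gt0 : (0 < D)%N.
Hypothesis hA : forall psi : (forall i, 'I_m -> 'I_(n i) -> L),
  multiaffine v A (contract psi t) = 0.
Hypothesis alphaA : alpha \notin A.
Hypothesis halpha : multiaffine v (alpha |: A) (contract phi t) != 0.

(** The factor in the chain rule for the variable [s i0], applied at [s i0 = 0]. *)
Definition deriv_at (x : multi_index n) (b : multi_index (fun _ : 'I_d => m))
    (s : {ffun 'I_d -> L}) : L :=
  multiaffine v (b |: A) (contract (perturb x (upd s i0 0)) t).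

(** Along the [s i0] line, [multiaffine v A] is a polynomial of degree at most [D] vanishing at the
    [D + 1] distinct points 0 and [p j]; so its linear coefficient is zero. *)
Lemma sum_deriv_slope x s :
  \sum_(b | b \notin A) deriv_at x b s * slope x i0 s b = 0.
Proof.
pose P := affine_line v A (contract (perturb x (upd s i0 0)) t) (slope x i0 s).
suff: P = 0 by rewrite -coef1_affine_line -/P => ->; rewrite coef0.
have root_P c : root P c.
  apply/eqP; rewrite horner_affine_line -[RHS](hA (perturb x (upd s i0 c))).
  apply: eq_bigr => S _; congr (_ * _); apply: eq_bigr => b _.
  by rewrite [RHS]contract_perturb_upd.
apply: (@roots_geq_poly_eq0 _ P (0 :: [seq p j | j <- enum 'I_D])).
- by apply/allP => c _.
- rewrite /= map_inj_uniq ?enum_uniq // andbT; apply/mapP => -[j _ e].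
  by have := hp0 j; rewrite -e eqxx.
rewrite /= size_map size_enum_ord (leq_trans (size_affine_line _ _ _ hv)) //.
by rewrite ltnS leq_subr.
Qed.

(** Deriving once more, along [b] outside [A], lowers the degree below [D], within reach of the [D]
    interpolation nodes. *)
Lemma poly_fun_deriv_at x b : b \notin A -> poly_fun D (deriv_at x b).
Proof.
move=> bA i s; have [->|ni] := eqVneq i i0.
  exists (deriv_at x b s)%:P; first by rewrite (leq_trans (size_polyC_leq1 _)).
  move=> c; rewrite hornerC; congr (multiaffine v _ (contract (perturb x _) t)).
  by apply/ffunP => k; rewrite !ffunE; case: eqP.
exists (affine_line v (b |: A) (contract (perturb x (upd (upd s i0 0) i 0)) t)
   (slope x i (upd s i0 0))).
  rewrite (leq_trans (size_affine_line _ _ _ hv)) // cardsU1 bA add1n.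
  by case: (D) D_gt0 => // k _; rewrite subSS ltnS leq_subr.
move=> c; rewrite horner_affine_line /deriv_at.
apply: eq_bigr => S _; congr (_ * _); apply: eq_bigr => g _.
rewrite /= -contract_perturb_upd; congr (contract (perturb x _) t g).
by apply/ffunP => k; rewrite !ffunE; case: (k =P i0) => // ->; rewrite eq_sym (negPf ni).
Qed.

(** Summing the chain rule identity over samples of [s] with suitable weights gives a relation
    between products of [flattening J b], local on [J], and a cofactor local off [J]. The full [J]
    yields [c0 * t x]; the proper ones are the terms of the decomposition. *)
Lemma partition_sum_of_vanishing :
  exists2 s : nat, partition_sum (finfun t : tensor L n) s &
    (s <= 2 ^ d * m ^ d.-1)%N.
Proof.
have [u hu] := interpolation_at_0 hp.
(* The weights [w] send s q(s) to q(0): a factor [s i] coming from [slope_expand] turns [w] into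
   [u]. *)
pose w j := u j / p j.
pose W (J : {set 'I_d}) i (j : 'I_D) := if i \in J then u j else w j.
pose rem (J : {set 'I_d}) b x := \sum_(sg : {ffun 'I_d -> 'I_D})
  (\prod_i W J i (sg i)) * deriv_at x b [ffun i => p (sg i)].
have remE (J : {set 'I_d}) b x : b \notin A -> rem J b x = \sum_(sg : {ffun 'I_d -> 'I_D})
  (\prod_i W J i (sg i)) * deriv_at x b (zero_on J [ffun i => p (sg i)]).
  move=> bA; apply: (sum_weights_zero_on D_gt0 hu (poly_fun_deriv_at x bA)) => i j iJ.
  by rewrite /W iJ.
(* The weights [u] on [J] set [s i = 0] there, which erases the dependence on [x i]. *)
have local_rem (J : {set 'I_d}) b : b \notin A -> i0 \in J -> local_on (~: J) (rem J b).
  move=> bA iJ x y exy; rewrite !remE //; apply: eq_bigr => sg _; congr (_ * _).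
  apply: eq_bigr => S _; congr (_ * _); apply: eq_bigr => g _.
  apply: eq_bigr => z _; congr (_ * _); apply: eq_bigr => i _.
  rewrite /perturb !ffunE; case: eqP => [_|_]; first by rewrite !mul0r.
  have [|iJ'] := boolP (i \in J); first by rewrite !mul0r.
  by rewrite /unit_entry exy // inE.
pose c0 := multiaffine v (alpha |: A) (contract phi t).
have u1 : \sum_j u j = 1.
  have := hu 1; rewrite size_poly1 hornerC => /(_ D_gt0) <-.
  by apply: eq_bigr => j _; rewrite hornerC mulr1.
(* For full [J] every [s i] becomes 0, so the derivative is taken at the unperturbed [phi]. *)
have rem_setT x : rem setT alpha x = c0.
  rewrite remE //.
  have E sg : deriv_at x alpha (zero_on setT [ffun i => p (sg i)]) = c0.
    apply: eq_bigr => S _; congr (_ * _); apply: eq_bigr => g _.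
    apply: eq_bigr => z _; congr (_ * _); apply: eq_bigr => i _.
    by rewrite /perturb !ffunE inE if_same mul0r addr0.
  under eq_bigr do rewrite E.
  rewrite -mulr_suml; have <- := bigA_distr_bigA (fun i j => W setT i j).
  rewrite big1 ?mul1r // => i _; rewrite -[RHS]u1; apply: eq_bigr => j _.
  by rewrite /W inE.
have main x : \sum_(J : {set 'I_d} | i0 \in J) \sum_(b | b \notin A)
    flattening J b x * rem J b x = 0.
  transitivity (\sum_(sg : {ffun 'I_d -> 'I_D}) (\prod_i W [set i0] i (sg i)) *
     (\sum_(b | b \notin A) deriv_at x b [ffun i => p (sg i)] *
          slope x i0 [ffun i => p (sg i)] b)); last first.
    by apply: big1 => sg _; rewrite sum_deriv_slope mulr0.
  under [RHS]eq_bigr do rewrite mulr_sumr.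
  rewrite [LHS]exchange_big [RHS]exchange_big /=; apply: eq_bigr => b _.
  under [RHS]eq_bigr do rewrite slope_expand !mulr_sumr.
  rewrite [RHS]exchange_big /=; apply: eq_bigr => J iJ.
  rewrite mulr_sumr; apply: eq_bigr => sg _.
  have <- : \prod_i W [set i0] i (sg i) *
      \prod_(i in J) (if i == i0 then 1 else [ffun i => p (sg i)] i) =
      \prod_i W J i (sg i); last first.
    by rewrite mulrC -!mulrA; congr (_ * _); rewrite mulrCA.
  rewrite [X in _ * X]big_mkcond -big_split /=; apply: eq_bigr => i _.
  rewrite /W /w inE ffunE; case: (i =P i0) => [->|_]; first by rewrite iJ mulr1.
  case: ifP => _; last by rewrite mulr1.
  by rewrite divfK.
pose X := multi_index (fun _ : 'I_d => m).
pose SQ := [set q : {set 'I_d} * X |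
   [&& i0 \in q.1, q.1 != setT & q.2 i0 == alpha i0]].
pose Q : finType := {q : {set 'I_d} * X | q \in SQ}.
have QP (q : Q) : [/\ i0 \in (val q).1, (val q).1 != setT & (val q).2 i0 = alpha i0].
  by have := valP q; rewrite inE => /and3P[? ? /eqP].
exists #|Q|; last first.
  (* Since [b i0] is fixed to [alpha i0], at most m^(d-1) entries go with each of at most 2^d
     sets. *)
  pose f (q : Q) := ((val q).1, restrict [set~ i0] (val q).2).
  have injf : injective f.
    move=> q1 q2 e; have [_ _ a1] := QP q1; have [_ _ a2] := QP q2.
    apply: val_inj; move: (f_equal fst e) (f_equal snd e) a1 a2; rewrite /f /=.
    case: (sval q1) (sval q2) => [J1 b1] [J2 b2] /= -> e2 a1 a2.
    congr (_, _); apply/ffunP => i; have [->|ni] := eqVneq i i0.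
      by rewrite a1 a2.
    have hi : i \in [set~ i0] by rewrite !inE.
    by move/ffunP/(_ (exist _ i hi)): e2; rewrite !ffunE.
  rewrite (leq_trans (leq_card f injf)) // card_prod -[X in (X * _)%N]cardsT -powersetT.
  rewrite card_powerset cardsT card_ord.
  by rewrite card_multi_index_sub cardsC1 card_ord.
(* Division by [- c0] solves for [t x]. Entries in [A] are absent from the chain rule and get zero
   factors. *)
pose a (q : Q) x := flattening (val q).1 (val q).2 x *
   ((val q).2 \notin A)%:R * (- c0^-1).
pose b (q : Q) x := if (val q).2 \notin A then rem (val q).1 (val q).2 x else 0.
apply: (@partition_sum_local _ _ _ _ _ (fun q => (val q).1) a b).
- move=> q; have [h1 h2 _] := QP q; rewrite /proper_nonempty properT h2.
  by rewrite andbT; apply/set0Pn; exists i0.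
- by move=> q x y exy; rewrite /a; congr (_ * _ * _); apply: local_flattening.
- move=> q x y exy; rewrite /b; case: ifP => // hb; apply: local_rem => //.
  by have [] := QP q.
move=> x; rewrite ffunE.
have := main x; rewrite (bigD1 setT) ?inE //= (bigD1 alpha) //=.
rewrite flattening_setT rem_setT [X in _ + X + _]big1 => [|g /andP[_ gal]]; last first.
  have /existsP[i gi] : [exists i, g i != alpha i].
    rewrite -negb_forall; apply: contra gal => /forallP e.
    by apply/eqP/ffunP => i; apply/eqP/e.
  by rewrite (@flattening_eq0 _ _ _ i) ?inE // mul0r.
have -> : \sum_(J : {set 'I_d} | (i0 \in J) && (J != setT)) \sum_(b0 : X | b0 \notin A)
    flattening J b0 x * rem J b0 x = \sum_q a q x * b q x * - c0.
  transitivity (\sum_(J : {set 'I_d} | (i0 \in J) && (J != setT))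
     \sum_(b0 : X | b0 i0 == alpha i0)
       flattening J b0 x * (b0 \notin A)%:R * rem J b0 x).
    apply: eq_bigr => J /andP[iJ _]; rewrite big_mkcond [RHS]big_mkcond /=.
    apply: eq_bigr => g _; have [gi|gi] := eqVneq (g i0) (alpha i0).
      by case: (g \notin A); rewrite ?mulr1 // mulr0 mul0r.
    by rewrite (flattening_eq0 _ iJ gi) mul0r if_same.
  rewrite pair_big_dep /=.
  rewrite (eq_bigl (mem SQ)) => [|[J g]]; last by rewrite [RHS]inE /= andbA.
  rewrite [LHS]big_sub; apply: eq_bigr => q _; rewrite /a /b.
  case: ((val q).2 \notin A); last by rewrite mulr0 !mul0r.
  by rewrite mulr1 -!mulrA; congr (_ * _); rewrite mulrCA mulrNN mulVf ?mulr1.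
by rewrite addr0 -mulr_suml mulrN => /eqP; rewrite subr_eq0 => /eqP /(mulIf halpha).
Qed.
End Core.

(** * An equation of bounded degree *)

Lemma bin_leq_exp2 n k : ('C(n, k) <= 2 ^ n)%N.
Proof.
rewrite -[X in ('C(X, _) <= _)%N]card_ord -card_draws.
by rewrite (leq_trans (max_card _)) // -cardsT -powersetT card_powerset cardsT card_ord.
Qed.

(** The binomial is a product of fractions (ck - i)/(k - i), each at least c. *)
Lemma expn_leq_bin c k : (c ^ k <= 'C(c * k, k))%N.
Proof.
case: c => [|c]; first by case: k => // k; rewrite exp0n.
rewrite -(leq_pmul2r (fact_gt0 k)) bin_ffact -ffactnn !ffact_prod.
rewrite -[X in (c.+1 ^ X)%N]card_ord -prod_nat_const -big_split /=.
apply: leq_prod => i _; rewrite mulnBr leq_sub2l //.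
by rewrite leq_pmull.
Qed.

(* The Smith normal form gives relations that are primitive, hence nontrivial *)
(* over every field.                                                          *)
Lemma primitive_relation (T : finType) (B : {set T}) (J : eqType) (s : seq J)
    (f : T -> J -> int) :
  (size s < #|B|)%N ->
  exists v : T -> int, [/\ forall x, v x != 0 -> x \in B,
    forall j, j \in s -> \sum_x v x * f x j = 0 &
    forall K : fieldType, exists x, (v x)%:~R != 0 :> K].
Proof.
case: s => [|j0 s'].
  rewrite card_gt0 => /set0Pn[x xB]; exists (fun y => (y == x)%:R); split=> //.
    by move=> y; case: (y =P x) => [->|]; rewrite // eqxx.
  by move=> K; exists x; rewrite eqxx oner_eq0.
set s := j0 :: s' => ltsB.
pose M : 'M[int]_(#|B|, size s) := \matrix_(i, j) f (enum_val i) (nth j0 s j).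
have [P uP [Q _ [dd _ defM]]] := int_Smith_normal_form M.
case: {-1}(#|B|) (erefl #|B|) => [e|k ek]; first by rewrite e in ltsB.
have kB : (k < #|B|)%N by rewrite ek.
(* The matrix has more rows than columns, so the last row of its Smith form is zero and [w] is a
   relation. As [w *m P] is a unit vector, [w] stays nonzero in every field. *)
pose w : 'rV_#|B| := row (Ordinal kB) (invmx P).
have wM : w *m M = 0.
  rewrite defM /w -row_mul !mulmxA mulVmx // mul1mx row_mul.
  rewrite (_ : row _ _ = 0) ?mul0mx //; apply/rowP => j; rewrite !mxE.
  case: eqP => // e; have := ltn_ord j; rewrite -e /= ltnNge => /negP[].
  by rewrite -ltnS -ek.
have wP : w *m P = delta_mx 0 (Ordinal kB) by rewrite -row_mul mulVmx // rowE mulmx1.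
pose v x := \sum_i w 0 i *+ (enum_val i == x).
have vE i : v (enum_val i) = w 0 i.
  rewrite /v (bigD1 i) //= eqxx big1 ?addr0 // => j ji.
  by rewrite (inj_eq enum_val_inj) (negPf ji).
exists v; split.
- move=> x; apply: contraR => xB; rewrite /v big1 // => i _.
  by case: eqP => // e; case/negP: xB; rewrite -e enum_valP.
- move=> j js; have js' : (index j s < size s)%N by rewrite index_mem.
  transitivity ((w *m M) 0 (Ordinal js')); last by rewrite wM mxE.
  rewrite mxE /v; under eq_bigr do rewrite mulr_suml.
  rewrite exchange_big /=; apply: eq_bigr => i _.
  rewrite (bigD1 (enum_val i)) //= big1 ?addr0 => [|x /negPf ex]; last first.
    by rewrite eq_sym ex mul0r.
  by rewrite eqxx mulr1n [M i _]mxE nth_index.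
move=> K; apply: contrapT => h.
have v0 i : (w 0 i)%:~R = 0 :> K.
  rewrite -vE; apply/eqP/negPn/negP => hi; apply: h; by exists (enum_val i).
have := congr1 (fun A : 'rV_#|B| => (A 0 (Ordinal kB))%:~R : K) wP.
rewrite /= [in RHS]mxE !eqxx /= mxE raddf_sum /= big1 => [/eqP|i _].
  by rewrite eq_sym oner_eq0.
by rewrite rmorphM /= v0 mul0r.
Qed.

Lemma exists_mdeg_enum N D : (0 < N)%N ->
  exists s : seq 'X_{1..N}, (forall m : 'X_{1..N}, mdeg m = D -> m \in s) /\
    (size s <= 2 ^ (D + N))%N.
Proof.
case: N => // n _; exists [seq s2m t | t : D.-tuple 'I_n.+1 <- enum (basis n.+1 D)].
split=> [m /eqP|]; first by rewrite basis_cover.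
by rewrite size_basis (leq_trans (bin_leq_exp2 _ _)) // leq_exp2l // leq_add2l.
Qed.

(** Each entry of the universal sum is a quadratic form in the source coordinates. *)
Lemma mdeg_prod_universal_sum (d : nat) (n : 'I_d -> nat) (r : nat)
    (I : 'I_r -> {set 'I_d}) (S : {set multi_index n}) m :
  m \in msupp (\prod_(x in S) universal_sum I x) -> mdeg m = (#|S| * 2)%N.
Proof.
move=> hm; apply: (dhomog_mf (d := #|S| * 2) (mf := mdeg) _ hm).
rewrite -sum_nat_const.
apply: (big_ind2 (fun (p : {mpoly int[#|source_coord n I|]}) e =>
  p \is @ishomog1 _ _ e mdeg)); first exact: dhomog1.
  by move=> p e p' e' hp hp'; apply: dhomogM.
move=> x _; apply: rpred_sum => i _; rewrite (_ : 2 = 1 + 1)%N //.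
by apply: dhomogM; rewrite /coordinate dhomogX; apply/eqP/mdeg1.
Qed.

Lemma exists_multiaffine_relation (d r m D : nat) (I : 'I_r -> {set 'I_d}) :
  (0 < D)%N -> (0 < #|source_coord (fun _ : 'I_d => m) I| <= D)%N ->
  #|multi_index (fun _ : 'I_d => m)| = (9 * D)%N ->
  exists v : {set multi_index (fun _ : 'I_d => m)} -> int,
  [/\ forall S, v S != 0 -> #|S| = D,
      multiaffine (fun S => (v S)%:~R) set0 (universal_sum I (n := fun=> m)) = 0 &
      forall K : fieldType, exists S, (v S)%:~R != 0 :> K].
Proof.
move=> D_gt0 /andP[N_gt0 leND] cardX.
have [s [sP szs]] := exists_mdeg_enum (D * 2) N_gt0.
pose B := [set S : {set multi_index (fun _ : 'I_d => m)} | #|S| == D].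
have ltsB : (size s < #|B|)%N.
  rewrite /B card_draws cardX (leq_trans _ (expn_leq_bin _ _)) //.
  (* With N <= D source variables, 2^(2D+N) <= 8^D < 9^D. *)
  apply: leq_ltn_trans szs _; apply: (@leq_ltn_trans (8 ^ D)).
    by rewrite -(expnM 2 3 D) leq_exp2l // (mulnC 3) (mulnSr D 2) leq_add2l.
  by rewrite ltn_exp2r.
have [v [vB vs vK]] := primitive_relation
  (fun (S : {set multi_index (fun _ : 'I_d => m)}) j =>
    (\prod_(x in S) universal_sum I x)@_j) ltsB.
exists v; split=> //; first by move=> S /vB; rewrite inE => /eqP.
apply/mpolyP => j; rewrite mcoeff0 /multiaffine raddf_sum /=.
have E S : mcoeff j ((v S)%:~R * \prod_(b in S :\: set0) universal_sum I b) =
    v S * (\prod_(x in S) universal_sum I x)@_j.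
  by rewrite setD0 mulrzl raddfMz /= -mulrzl intz.
under eq_bigr do rewrite E.
rewrite (eq_bigl xpredT) => [|S]; last by rewrite sub0set.
have [/vs //|js] := boolP (j \in s).
apply: big1 => S _; have [->|/vB] := eqVneq (v S) 0; first by rewrite mul0r.
rewrite inE => /eqP cS; rewrite memN_msupp_eq0 ?mulr0 //.
by apply: contra js => /mdeg_prod_universal_sum; rewrite cS; apply: sP.
Qed.

(** * Vanishing on border sums *)

Lemma rmorph_multiaffine (R S : comNzRingType) (f : {rmorphism R -> S})
    (X : finType) (v : {set X} -> int) A (y : X -> R) :
  f (multiaffine (fun S => (v S)%:~R) A y) =
  multiaffine (fun S => (v S)%:~R) A (f \o y).
Proof.
rewrite rmorph_sum; apply: eq_bigr => B _.
by rewrite rmorphM rmorph_prod rmorph_int.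
Qed.

Lemma eq_multiaffine (R : comNzRingType) (X : finType) (v : {set X} -> R) A
    (y y' : X -> R) : y =1 y' -> multiaffine v A y = multiaffine v A y'.
Proof.
by move=> e; apply: eq_bigr => S _; congr (_ * _); apply: eq_bigr => x _.
Qed.

Lemma rmorph_contract (R S : comNzRingType) (f : {rmorphism R -> S}) (d m : nat)
    (n : 'I_d -> nat) (phi : forall i, 'I_m -> 'I_(n i) -> R) t b :
  f (contract phi t b) = contract (fun i b z => f (phi i b z)) (f \o t) b.
Proof.
rewrite rmorph_sum; apply: eq_bigr => z _.
by rewrite rmorphM rmorph_prod.
Qed.

(** Specialise the formal relation at the entries of [a] and [b]. The ring [R] is arbitrary so that
    generic linear maps, with indeterminate entries, are covered. *)
Lemma vanishing_on_sums (R : comNzRingType) (d r m : nat) (I : 'I_r -> {set 'I_d})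
    (v : {set multi_index (fun _ : 'I_d => m)} -> int)
    (a b : 'I_r -> multi_index (fun _ : 'I_d => m) -> R) y :
  multiaffine (fun S => (v S)%:~R) set0 (universal_sum I (n := fun=> m)) = 0 ->
  (forall i, local_on (I i) (a i)) -> (forall i, local_on (~: I i) (b i)) ->
  (forall x, y x = \sum_i a i x * b i x) ->
  (0 < #|multi_index (fun _ : 'I_d => m)|)%N ->
  multiaffine (fun S => (v S)%:~R) set0 y = 0.
Proof.
move=> hv ha hb hy /card_gt0P[x0 _].
pose h (k : 'I_#|source_coord (fun _ : 'I_d => m) I|) : R :=
  match enum_val k with
  | existT i (inl u) => a i (glue u (restrict (~: I i) x0))
  | existT i (inr u) => b i (glue (restrict (I i) x0) u)
  end.
have := congr1 (mmap (intr : int -> R) h) hv.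
rewrite rmorph_multiaffine rmorph0 => e; rewrite -[RHS]e.
apply: eq_multiaffine => x; rewrite hy [RHS]/= /universal_sum rmorph_sum; apply: eq_bigr => i _.
rewrite rmorphM /= /coordinate !mmapX !mmap1U /h !enum_rankK.
by rewrite /source_left /source_right (local_extend _ _ (ha i)) (local_extendC _ _ (hb i)).
Qed.

Definition partial_contract (R : comNzRingType) (d m : nat) (n : 'I_d -> nat)
    (phi : forall i, 'I_m -> 'I_(n i) -> R) (I : {set 'I_d})
    (a : multi_index (sub_dims n (I := I)) -> R)
    (x : multi_index (fun _ : 'I_d => m)) : R :=
  \sum_u a u * \prod_(j : {j | j \in I}) phi (val j) (x (val j)) (u j).

Lemma local_partial_contract (R : comNzRingType) (d m : nat) (n : 'I_d -> nat)
    (phi : forall i, 'I_m -> 'I_(n i) -> R) (I : {set 'I_d})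
    (a : multi_index (sub_dims n (I := I)) -> R) :
  local_on I (partial_contract phi a).
Proof.
move=> x y exy; apply: eq_bigr => u _; congr (_ * _).
by apply: eq_bigr => -[j hj] _ /=; rewrite exy.
Qed.

Lemma contract_sum_mul (R : comNzRingType) (d m r : nat) (n : 'I_d -> nat)
    (phi : forall i, 'I_m -> 'I_(n i) -> R) (I : 'I_r -> {set 'I_d})
    (a : forall i, multi_index (sub_dims n (I := I i)) -> R)
    (b : forall i, multi_index (sub_dims n (I := ~: I i)) -> R) x :
  contract phi
    (fun z => \sum_i a i (restrict (I i) z) * b i (restrict (~: I i) z)) x =
  \sum_i partial_contract phi (a i) x * partial_contract phi (b i) x.
Proof.
rewrite /contract; under eq_bigr do rewrite mulr_suml.
rewrite exchange_big; apply: eq_bigr => i _; rewrite (sum_glue (I i)).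
rewrite mulr_suml; apply: eq_bigr => u _; rewrite mulr_sumr.
apply: eq_bigr => w _; rewrite restrict_glueL restrict_glueR.
rewrite (prod_glue (fun j z => phi j (x j) z)) -!mulrA; congr (_ * _).
by rewrite mulrCA.
Qed.

(** The closure is tested by integral polynomials in [t] alone, whereas [phi] has entries in [L]. So
    [phi] is first made generic: the coefficients of [G] in its indeterminate entries are such
    polynomials, and they vanish on the image. *)
Lemma border_vanishing (K L : fieldType) (iota : {rmorphism K -> L})
    (d r m : nat) (n : 'I_d -> nat) (I : 'I_r -> {set 'I_d}) (t : tensor K n)
    (v : {set multi_index (fun _ : 'I_d => m)} -> int)
    (phi : forall i, 'I_m -> 'I_(n i) -> L) :
  multiaffine (fun S => (v S)%:~R) set0 (universal_sum I (n := fun=> m)) = 0 ->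
  (0 < #|multi_index (fun _ : 'I_d => m)|)%N ->
  zariski_closure (spec_image (comorphism (universal_sum I (n := n))))
    (field_point t) ->
  multiaffine (fun S => (v S)%:~R) set0 (contract phi (map_tensor iota t)) = 0.
Proof.
move=> hv cX ht.
pose E : finType := {i : 'I_d & ('I_m * 'I_(n i))%type}.
pose co (i : 'I_d) (b : 'I_m) (z : 'I_(n i)) : E := existT _ i (b, z).
pose gen (R : comNzRingType) i b z : {mpoly R[#|E|]} := 'X_(enum_rank (@co i b z)).
pose G : {mpoly (Zpoly (multi_index n))[#|E|]} :=
  multiaffine (fun S => (v S)%:~R) set0
    (contract (@gen _) (fun x => (coordinate x)%:MP)).
pose com := comp_mpoly [tuple universal_sum I (enum_val i) | i < #|multi_index n|].
have G0 : map_mpoly com G = 0.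
  rewrite /G rmorph_multiaffine.
  pose R' : comNzRingType := {mpoly (Zpoly (source_coord n I))[#|E|]}.
  pose a i (u : multi_index (sub_dims n (I := I i))) : R' :=
    (coordinate (source_left u))%:MP.
  pose b i (u : multi_index (sub_dims n (I := ~: I i))) : R' :=
    (coordinate (source_right u))%:MP.
  refine (@vanishing_on_sums R' d r m I v
    (fun i => partial_contract (gen _) (a i)) (fun i => partial_contract (gen _) (b i))
    _ hv _ _ _ cX) => [i|i|x]; [exact: local_partial_contract..|].
  rewrite [LHS]/= rmorph_contract -contract_sum_mul.
  apply: eq_bigr => z _; congr (_ * _).
    rewrite /= map_mpolyC /= /com /coordinate comp_mpolyXU -tnth_nth tnth_mktuple.
    by rewrite enum_rankK rmorph_sum; apply: eq_bigr => i _; rewrite rmorphM.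
  by apply: eq_bigr => i _; rewrite /= /gen map_mpolyX.
pose ev : Zpoly (multi_index n) -> K := mmap (intr : int -> K) (fun i => t (enum_val i)).
have ev0 j : ev G@_j = 0.
  have /ht /(_ _ erefl) : forall q, spec_image (comorphism (universal_sum I (n := n))) q ->
      zero_locus (eq G@_j) q.
    move=> q [p [[p0 _ _] _] qp] _ <-; rewrite qp inE.
    have -> : comorphism (universal_sum I (n := n)) G@_j = (map_mpoly com G)@_j.
      by symmetry; apply: mcoeff_map_mpoly.
    by rewrite G0 mcoeff0.
  by rewrite inE => /eqP.
(* Specialise the indeterminates to the entries of [phi]. *)
pose h (k : 'I_#|E|) : L := let: existT i (b, z) := enum_val k in phi i b z.
have : mmap (iota \o ev) h G = 0.
  by rewrite /mmap big1 // => j _; rewrite /= ev0 rmorph0 mul0r.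
move=> e; rewrite -[RHS]e rmorph_multiaffine; apply: eq_multiaffine => x.
rewrite [RHS]/= rmorph_contract; apply: eq_bigr => z _; congr (_ * _).
  by rewrite /= mmapC /= /ev /coordinate mmapX mmap1U enum_rankK ffunE.
by apply: eq_bigr => i _; rewrite /= /gen mmapX mmap1U /h enum_rankK.
Qed.

(** * Field extensions *)

Definition descends (K L : fieldType) (iota : {rmorphism K -> L}) (k : nat) :=
  forall d (n : 'I_d -> nat) (t : tensor K n) s,
    partition_sum (map_tensor iota t) s -> partition_sum t (k * s).

(** Expand the left factors in a [K]-basis of [L] and apply a [K]-linear retraction [lam] of
    [K -> L]; each product yields one term per basis vector. *)
Lemma descends_extension (K : fieldType) (L : fieldExtType K) :
  descends (in_alg L) (\dim {:L}).
Proof.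
move=> d n t s [I [a [b [hI ht]]]].
pose e := vbasis {:L}.
(* Some coordinate of 1 is nonzero; normalised, it gives [lam] with value 1 at 1. *)
have [k ek] : exists k, coord e k 1 != 0.
  apply: contrapT => h; have := coord_vbasis (memvf (1 : L)); rewrite big1 => [/eqP|k _].
    by rewrite oner_eq0.
  rewrite (_ : coord e k 1 = 0) ?scale0r //.
  by apply/eqP/negPn/negP => hk; apply: h; exists k.
pose lam y := coord e k y / coord e k 1.
have lamA x : lam (in_alg L x) = x by rewrite /lam linearZ /= mulfK.
have lamD : {morph lam : x y / x + y} by move=> x y; rewrite /lam linearD mulrDl.
have lam0 : lam 0 = 0 by rewrite /lam linear0 mul0r.
have lamZ c y : lam (c *: y) = c * lam y by rewrite /lam linearZ mulrA.
rewrite -[(_ * s)%N](_ : #|({: 'I_(\dim {:L}) * 'I_s})| = _); last first.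
  by rewrite card_prod !card_ord.
apply: (@partition_sum_local _ _ _ _ _ (fun q => I q.2)
  (fun q x => coord e q.1 (a q.2 (restrict (I q.2) x)))
  (fun q x => lam (e`_q.1 * b q.2 (restrict (~: I q.2) x)))) => //.
- move=> q x y exy; congr (coord e _ (a _ _)).
  by apply/ffunP => -[j hj]; rewrite !ffunE exy.
- move=> q x y exy; congr (lam (_ * b _ _)).
  by apply/ffunP => -[j hj]; rewrite !ffunE exy.
move=> x; rewrite -[LHS]lamA.
have -> : in_alg L (t x) = \sum_i a i (restrict (I i) x) * b i (restrict (~: I i) x).
  have := congr1 (fun f : tensor L n => f x) ht.
  rewrite sum_ffunE ffunE => ->; apply: eq_bigr => i _; by rewrite ffunE.
rewrite (big_morph lam lamD lam0) -(pair_big xpredT xpredT (fun l i =>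
   coord e l (a i (restrict (I i) x)) * lam (e`_l * b i (restrict (~: I i) x)))) /=.
rewrite exchange_big /=; apply: eq_bigr => i _.
rewrite {1}(coord_vbasis (memvf (a i _))) mulr_suml (big_morph lam lamD lam0).
by apply: eq_bigr => l _; rewrite -scalerAl lamZ.
Qed.

Lemma descends_id (K : fieldType) : descends (idfun : {rmorphism K -> K}) 1.
Proof.
move=> d n t s; rewrite mul1n (_ : map_tensor _ t = t) //.
by apply/ffunP => x; rewrite ffunE.
Qed.

Lemma descends_comp (K L M : fieldType) (f : {rmorphism K -> L})
    (g : {rmorphism L -> M}) k l :
  descends f k -> descends g l -> descends (g \o f) (k * l).
Proof.
move=> hf hg d n t s ht; rewrite -mulnA; apply: hf; apply: hg.
rewrite (_ : map_tensor g _ = map_tensor (g \o f) t) //.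
by apply/ffunP => x; rewrite !ffunE.
Qed.

(** On a finite field x^2 - x takes the same value at 0 and 1, so it misses some a; then X^2 - X - a
    has no root, in any characteristic. *)
Lemma quadratic_extension (K : fieldType) (e : seq K) : (forall x, x \in e) ->
  exists L : fieldExtType K, \dim {:L} = 2%N.
Proof.
move=> he; pose g (x : K) := x ^+ 2 - x.
have [a ha] : exists a, forall x, g x != a.
  apply: contrapT => h.
  have gs a : exists x, g x = a.
    apply: contrapT => ha; apply: h; exists a => x; apply/eqP => gx.
    by apply: ha; exists x.
  have se : {subset undup e <= map g (undup e)}.
    move=> a _; have [x <-] := gs a; apply: map_f; by rewrite mem_undup.
  have := leq_size_uniq (undup_uniq e) se; rewrite size_map leqnn => /(_ isT).
  move=> u; have /eqP : index (0 : K) (undup e) = index 1 (undup e).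
    apply/eqP; rewrite -(@nth_uniq _ (g 0) (map g (undup e))) ?size_map ?index_mem ?mem_undup //.
    rewrite !(nth_map 0) ?index_mem ?mem_undup // !nth_index ?mem_undup //.
    by rewrite /g expr0n expr1n subr0 subrr.
  move=> /eqP /(f_equal (nth 0 (undup e))); rewrite !nth_index ?mem_undup //.
  by move=> /eqP; rewrite eq_sym oner_eq0.
pose p : {poly K} := 'X^2 - 'X - a%:P.
have szp : size p = 3%N.
  have h : (size ('X + a%:P)%R <= 2)%N.
    by rewrite (leq_trans (size_polyD _ _)) // geq_max size_polyX (leq_trans (size_polyC_leq1 _)).
  by rewrite /p -addrA -opprD size_polyDl ?size_polyN size_polyXn.
have irrp : irreducible_poly p.
  apply: cubic_irreducible; rewrite ?szp // => x.
  by rewrite /root !hornerE subr_eq0; apply: ha.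
have [L dimL _] := irredp_FAdjoin irrp.
by exists L; rewrite dimL szp.
Qed.

Lemma enum_extension (K : fieldType) (L : fieldExtType K) (e : seq K) :
  uniq e -> (forall x, x \in e) ->
  exists e' : seq L, [/\ uniq e', forall x, x \in e' &
    size e' = (size e ^ \dim {:L})%N].
Proof.
move=> ue he; pose b := vbasis {:L}.
pose F (g : {ffun 'I_(\dim {:L}) -> 'I_(size e)}) : L :=
  \sum_i e`_(g i) *: b`_i.
have freeb : free b := basis_free (vbasisP _).
exists (codom F); split.
- rewrite /codom /image_mem map_inj_uniq ?enum_uniq // => g h eF.
  apply/ffunP => i; apply: val_inj; apply/eqP.
  rewrite -(nth_uniq 0 (ltn_ord _) (ltn_ord _) ue).
  by have := congr1 (coord b i) eF; rewrite /F !coord_sum_free // => ->.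
- move=> x; apply/codomP.
  have hi y : (index y e < size e)%N by rewrite index_mem.
  exists [ffun i => Ordinal (hi (coord b i x))].
  rewrite {1}(coord_vbasis (memvf x)); apply: eq_bigr => i _.
  by rewrite ffunE /= nth_index.
by rewrite size_codom card_ffun !card_ord.
Qed.

(** An enumeration is carried up the tower, since each quadratic step requires one. *)
Lemma finite_field_tower j (K : fieldType) (e : seq K) :
  uniq e -> (forall x, x \in e) ->
  exists (L : fieldType) (iota : {rmorphism K -> L}), descends iota (2 ^ j) /\
    exists e' : seq L, uniq e' /\ size e' = (size e ^ (2 ^ j))%N.
Proof.
elim: j K e => [|j IH] K e ue he.
  by exists K, idfun; split; [apply: descends_id | exists e; rewrite expn1].
have [L dimL] := quadratic_extension he.
have [e' [ue' he' sze']] := enum_extension L ue he.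
have [M [iota [hM [e'' [ue'' sze'']]]]] := IH L e' ue' he'.
exists M, (iota \o in_alg L); split.
  by rewrite expnS; apply: descends_comp hM; rewrite -dimL; apply: descends_extension.
by exists e''; rewrite sze'' sze' dimL -expnM -expnS.
Qed.

Lemma nonzero_points (L : fieldType) (e : seq L) D : uniq e -> (D < size e)%N ->
  exists p : 'I_D -> L, injective p /\ forall j, p j != 0.
Proof.
move=> ue lt; pose f := rem 0 e.
have uf : uniq f by rewrite rem_uniq.
have szf : (D <= size f)%N.
  rewrite /f; have [h|h] := boolP (0 \in e); first by rewrite size_rem // -ltnS prednK // (leq_trans _ lt).
  by rewrite rem_id // ltnW.
have lt' (j : 'I_D) : (j < size f)%N := leq_trans (ltn_ord j) szf.
exists (fun j => f`_j); split.
  move=> i j /eqP; rewrite nth_uniq // => /eqP ij; exact: val_inj.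
move=> j; apply/eqP => e0; have : 0 \in f by rewrite -e0 mem_nth.
by rewrite mem_rem_uniq // inE eqxx.
Qed.

Lemma infinite_uniq_seq (T : choiceType) : infinite_set [set: T]%classic ->
  forall N, exists e : seq T, uniq e /\ size e = N.
Proof.
move=> infT; elim=> [|N [e [ue sze]]]; first by exists [::].
have [x xe] : exists x, x \notin e.
  apply: contrapT => h; apply: infT; apply/finite_seqP; exists e.
  apply/seteqP; split=> // x _; apply: contrapT => xe; apply: h.
  by exists x; apply/negP.
by exists (x :: e); rewrite /= xe ue sze.
Qed.

Lemma finite_enum (T : choiceType) : finite_set [set: T]%classic ->
  exists e : seq T, uniq e /\ forall x, x \in e.
Proof.
move=> /finite_seqP[e he]; exists (undup e); split; first exact: undup_uniq.
move=> x; rewrite mem_undup.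
by have : [set: T]%classic x by []; rewrite he.
Qed.

(** * Bounds *)

Lemma card_source_coord (d r m : nat) (I : 'I_r -> {set 'I_d}) :
  (0 < r)%N -> (0 < m)%N -> (forall i, proper_nonempty (I i)) ->
  (0 < #|source_coord (fun _ : 'I_d => m) I| <= 2 * r * m ^ d.-1)%N.
Proof.
move=> r0 m0 hI.
have -> : #|source_coord (fun _ : 'I_d => m) I| =
    (\sum_(i < r) (m ^ #|I i| + m ^ #|~: I i|))%N.
  rewrite card_tagged sumnE big_map big_enum /=; apply: eq_bigr => i _.
  by rewrite card_sum !card_multi_index_sub.
apply/andP; split; first by rewrite (bigD1 (Ordinal r0)) //= !addn_gt0 expn_gt0 m0.
rewrite (mulnC 2) -mulnA -[X in (_ <= X * _)%N]card_ord.
rewrite -sum_nat_const; apply: leq_sum => i _; have /andP[I0 /proper_card] := hI i.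
rewrite cardsT card_ord => Id; rewrite mul2n -addnn leq_add // leq_pexp2l //.
  by rewrite -ltnS (ltn_predK Id).
by rewrite -ltnS (ltn_predK Id) cardsCs setCK card_ord ltn_subrL card_gt0 I0 (leq_ltn_trans _ Id).
Qed.

Lemma border_bound (K L : fieldType) (iota : {rmorphism K -> L}) (d r : nat)
    (n : 'I_d -> nat) (t : tensor K n) (e : seq L) :
  (0 < d)%N -> (0 < r)%N -> uniq e ->
  (2 * r * (18 * r) ^ d.-1 < size e)%N -> border_partition_sum t r ->
  exists2 s, partition_sum (map_tensor iota t) s &
    (s <= 2 ^ d * (18 * r) ^ d.-1)%N.
Proof.
move=> d0 r0 ue sze [I [hI ht]]; set m := (18 * r)%N in sze *.
set D := (2 * r * m ^ d.-1)%N in sze.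
have m0 : (0 < m)%N by rewrite muln_gt0.
have D0 : (0 < D)%N by rewrite !muln_gt0 r0 expn_gt0 m0.
(* This is where m = 18 r enters: m^d = 18 r m^(d-1) = 9 D. *)
have cX : #|multi_index (fun _ : 'I_d => m)| = (9 * D)%N.
  rewrite card_multi_index prod_nat_const card_ord -[in LHS](prednK d0) expnS.
  by rewrite /D mulnA mulnA.
have [v [vD v0 vK]] := exists_multiaffine_relation D0 (card_source_coord r0 m0 hI) cX.
have cX0 : (0 < #|multi_index (fun _ : 'I_d => m)|)%N by rewrite cX muln_gt0.
pose vL S : L := (v S)%:~R.
have vLD S : vL S != 0 -> #|S| = D.
  move=> h; apply: vD; apply: contraNneq h => e0; by rewrite /vL e0.
have [S0 vS0] := vK L.
have hphi (phi : forall i, 'I_m -> 'I_(n i) -> L) :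
    multiaffine vL set0 (contract phi (map_tensor iota t)) = 0.
  exact: border_vanishing v0 cX0 ht.
(* The zero tuple serves to inhabit the type of tuples [phi]. *)
have [A [al [alA hA [phi halpha]]]] := last_vanishing_derivative
  (y := fun phi => contract phi (map_tensor iota t)) vLD vS0 (fun _ _ _ => 0) hphi.
have [p [injp p0]] := nonzero_points ue sze.
have [s hs les] := partition_sum_of_vanishing (Ordinal d0) vLD p0 injp D0 hA alA
  (introN eqP halpha).
exists s => //; rewrite (_ : map_tensor iota t = finfun (map_tensor iota t)) //.
by apply/ffunP => x; rewrite !ffunE.
Qed.

Lemma exists_minimum (P : nat -> Prop) s : P s ->
  exists r, is_minimum P r /\ (r <= s)%N.
Proof.
move=> Ps; have h : exists r, `[< P r >] by exists s; apply/asboolP.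
case: (ex_minnP h) => r /asboolP Pr minr; exists r; split.
  by split=> // u Pu; apply: minr; apply/asboolP.
by apply: minr; apply/asboolP.
Qed.

(** * Border rank against partition rank over an extension *)

Lemma rmorph_mpoly_int (N : nat) (S : comNzRingType)
    (f : {rmorphism {mpoly int[N]} -> S}) p :
  f p = mmap (intr : int -> S) (fun i => f 'X_i) p.
Proof.
rewrite {1}[p]mpolyE rmorph_sum; apply: eq_bigr => j _.
rewrite -mul_mpolyC rmorphM mpolyXE_id rmorph_prod; congr (_ * _).
  by rewrite -[p@_j in LHS]intz !rmorph_int.
by apply: eq_bigr => i _; rewrite rmorphXn.
Qed.

Lemma prime_ideal_ker (A : comNzRingType) (L : fieldType) (f : {rmorphism A -> L}) :
  prime_ideal [pred x | f x == 0].
Proof.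
split; first split.
- by rewrite inE rmorph0.
- by rewrite inE rmorph1 oner_eq0.
- move=> a x y; rewrite !inE => /eqP hx /eqP hy.
  by rewrite rmorphD rmorphM hx hy mulr0 addr0.
by move=> x y; rewrite !inE rmorphM mulf_eq0.
Qed.

(** A decomposition over [L] is an [L]-point of the source. Its kernel is a prime lying over the
    point of [t], because [iota] is injective, so [t] is already in the image. *)
Lemma border_partition_sum_map (K L : fieldType) (iota : {rmorphism K -> L})
    (d : nat) (n : 'I_d -> nat) (t : tensor K n) r :
  partition_sum (map_tensor iota t) r -> border_partition_sum t r.
Proof.
move=> [I [a [b [hI ht]]]]; exists I; split=> // F hF; apply: (hF (field_point t)).
pose h (k : 'I_#|source_coord n I|) : L :=
  match enum_val k with
  | existT i (inl u) => a i u
  | existT i (inr u) => b i u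
  end.
pose ev : Zpoly (source_coord n I) -> L := mmap (intr : int -> L) h.
pose evt : Zpoly (multi_index n) -> K := mmap (intr : int -> K) (fun i => t (enum_val i)).
pose com := comp_mpoly [tuple universal_sum I (enum_val i) | i < #|multi_index n|].
pose q : {pred Zpoly (source_coord n I)} := [pred f | ev f == 0].
exists q; first exact: prime_ideal_ker.
suff E f : ev (com f) = iota (evt f) by move=> f; rewrite !inE /= E fmorph_eq0.
rewrite -[LHS]/((ev \o com) f) -[RHS]/((iota \o evt) f).
rewrite (rmorph_mpoly_int (ev \o com)) (rmorph_mpoly_int (iota \o evt)).
apply: eq_bigr => j _; congr (_ * _); apply: eq_bigr => i _; congr (_ ^+ _).
rewrite /= /com comp_mpolyXU -tnth_nth tnth_mktuple /evt mmapX mmap1U.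
have := congr1 (fun f : tensor L n => f (enum_val i)) ht.
rewrite ffunE sum_ffunE => ->; rewrite /universal_sum rmorph_sum.
apply: eq_bigr => k _; rewrite rmorphM ffunE /= /ev /coordinate !mmapX !mmap1U.
by rewrite /h !enum_rankK.
Qed.

(** For [r = 0] all coordinate functions vanish on the image. This case is separate because [18 * r]
    must be positive in the main argument. *)
Lemma border_partition_sum0 (K : fieldType) (d : nat) (n : 'I_d -> nat)
    (t : tensor K n) : border_partition_sum t 0 -> partition_sum t 0.
Proof.
move=> [I [hI ht]]; exists I, (fun _ => 0), (fun _ => 0); split=> //.
rewrite big_ord0; apply/ffunP => x; rewrite ffunE.
have /ht /(_ _ erefl) : forall q, spec_image (comorphism (universal_sum I (n := n))) q ->
    zero_locus (eq (coordinate x)) q.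
  move=> q [p [[p0 _ _] _] qp] _ <-; rewrite qp inE /comorphism /coordinate.
  by rewrite comp_mpolyXU -tnth_nth tnth_mktuple /universal_sum big_ord0.
by rewrite inE /coordinate mmapX mmap1U enum_rankK => /eqP.
Qed.

(** * Logarithmic estimates *)

Lemma log2_le (R : realType) (r : nat) : log2 (r%:R + 1) <= r%:R :> R.
Proof.
have ln2 : 0 < ln 2 :> R by rewrite ln_gt0 // ltr1n.
rewrite /log2 ler_pdivrMr // mulrC mulr_natr -lnXn // ler_ln ?posrE ?exprn_gt0 //.
  by rewrite natr1 -natrX ler_nat ltn_expl.
by rewrite natr1.
Qed.

Lemma le_log2 (R : realType) (k r : nat) : (2 ^ k <= r.+1)%N ->
  k%:R <= log2 (r%:R + 1) :> R.
Proof.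
move=> h; have ln2 : 0 < ln 2 :> R by rewrite ln_gt0 // ltr1n.
rewrite /log2 ler_pdivlMr // mulrC mulr_natr -lnXn // ler_ln ?posrE ?exprn_gt0 //.
  by rewrite natr1 -natrX ler_nat.
by rewrite natr1.
Qed.

(** Rounding up adds at most 1, and 1 is at most the logarithm itself when [r] is positive. *)
Lemma up_log_le_log2 (R : realType) (r : nat) : (0 < r)%N ->
  (up_log 2 r.+1)%:R <= 2 * log2 (r%:R + 1) :> R.
Proof.
move=> r0; have h : (2 ^ (up_log 2 r.+1).-1 < r.+1)%N by apply: up_log_gtn.
have h1 := le_log2 R (ltnW h).
have h2 : 1%:R <= log2 (r%:R + 1) :> R by apply: le_log2.
have l0 : (0 < up_log 2 r.+1)%N by rewrite up_log_gt0.
by rewrite -(prednK l0) -natr1 mulrDl mul1r lerD.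
Qed.

(** * Bounds over infinite and over finite fields *)

Lemma rank_bound_infinite (K : fieldType) (d r : nat) (n : 'I_d -> nat)
    (t : tensor K n) :
  (0 < d)%N -> (0 < r)%N -> infinite_set [set: K]%classic ->
  border_partition_sum t r ->
  exists2 s, partition_sum t s & (s <= 2 ^ d * (18 * r) ^ d.-1)%N.
Proof.
move=> d0 r0 infK ht.
have [e [ue sze]] := infinite_uniq_seq infK (2 * r * (18 * r) ^ d.-1).+1.
have [|s hs les] := border_bound (idfun : {rmorphism K -> K}) d0 r0 ue _ ht; first by rewrite sze.
by exists s => //; rewrite -[s]mul1n; apply: descends_id.
Qed.

Lemma rank_bound_finite (K : fieldType) (d r : nat) (n : 'I_d -> nat)
    (t : tensor K n) :
  (0 < d)%N -> (0 < r)%N -> finite_set [set: K]%classic ->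
  border_partition_sum t r ->
  exists2 s, partition_sum t s &
    (s <= 12 * d * up_log 2 r.+1 * (2 ^ d * (18 * r) ^ d.-1))%N.
Proof.
move=> d0 r0 finK ht; set l := up_log 2 r.+1.
have l0 : (0 < l)%N by rewrite up_log_gt0.
have [e [ue he]] := finite_enum finK.
have sze : (2 <= size e)%N.
  have : uniq [:: 0; 1 : K] by rewrite /= inE eq_sym oner_eq0.
  by move=> u; apply: (uniq_leq_size u) => x _; apply: he.
(* Since 18 r <= 2^(5+l) <= 2^(6l), one has (18 r)^d <= 2^k, so degree [k] over a field with at
   least two elements gives enough points. The degree is then rounded up to a power of 2, at most
   [2 * k]. *)
pose k := (6 * l * d)%N; have k1 : (1 < k)%N by rewrite /k -mulnA (@leq_trans 6) // leq_pmulr // muln_gt0 l0.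
pose j := up_log 2 k; have kj : (k <= 2 ^ j)%N by apply: up_logP.
have jk : (2 ^ j <= 2 * k)%N.
  have j0 : (0 < j)%N by rewrite up_log_gt0.
  by rewrite -(prednK j0) expnS leq_mul2l /= ltnW // up_log_gtn.
have [L [iota [hL [e' [ue' sze']]]]] := finite_field_tower j ue he.
have lt : (2 * r * (18 * r) ^ d.-1 < size e')%N.
  rewrite sze'; apply: (@leq_trans ((18 * r) ^ d)).
    rewrite -[in X in (_ < X)%N](prednK d0) expnS ltn_pmul2r ?expn_gt0 ?muln_gt0 ?r0 //.
    by rewrite ltn_pmul2r.
  apply: (@leq_trans (2 ^ k)).
    rewrite /k expnM leq_exp2r // (@leq_trans (2 ^ (5 + l))) //.
      rewrite expnD leq_mul // ltnW //; exact: up_logP.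
    by rewrite leq_exp2l // (mulSn 5) addnC leq_add2l leq_pmulr.
  by rewrite (leq_trans (leq_pexp2l _ kj)) // leq_exp2r // expn_gt0.
have [s hs les] := border_bound iota d0 r0 ue' lt ht.
exists (2 ^ j * s)%N; first exact: hL.
apply: leq_mul => //; apply: leq_trans jk _.
by rewrite /k mulnA mulnA mulnAC.
Qed.

Unset Implicit Arguments.

Theorem theorem1p14 (R : realType) (d : nat) (hd : (1 <= d)%N) :
  (exists C : R, 0 < C /\
    forall (K : fieldType) (n : 'I_d -> nat) (t : tensor K n) (r : nat),
      border_partition_rank t r ->
      (infinite_set [set: K]%classic ->
        exists s : nat, partition_rank t s /\
          s%:R <= C * r%:R ^+ (d - 1)) /\
      (finite_set [set: K]%classic ->
        exists s : nat, partition_rank t s /\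
          s%:R <= C * r%:R ^+ (d - 1) * log2 (r%:R + 1)))
  /\
  (exists P : {poly R},
    forall (K : fieldType) (n : 'I_d -> nat) (t : tensor K n)
      (Kbar : fieldType) (iota : {rmorphism K -> Kbar}),
      algebraic_closure iota ->
      forall r : nat, partition_rank (map_tensor iota t) r ->
      exists s : nat, partition_rank t s /\ s%:R <= P.[r%:R]).
Proof.
(* The finite case dictates [C]: a factor 12 d from the extension degree, and 2 from
   [up_log_le_log2]. *)
pose c := (2 ^ d * 18 ^ d.-1)%N; pose C : R := (24 * d * c)%:R.
have C0 : 0 < C by rewrite ltr0n !muln_gt0 hd !expn_gt0.
have main (K : fieldType) (n : 'I_d -> nat) (t : tensor K n) (r : nat) :
  border_partition_sum t r ->
  (infinite_set [set: K]%classic ->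
    exists s : nat, partition_rank t s /\ s%:R <= C * r%:R ^+ d.-1) /\
  (finite_set [set: K]%classic ->
    exists s : nat, partition_rank t s /\
      s%:R <= C * r%:R ^+ d.-1 * log2 (r%:R + 1)).
  have [->|] := posnP r.
    move=> /border_partition_sum0 /exists_minimum[s [ms]]; rewrite leqn0 => /eqP s0.
    split=> _; exists s; split=> //; rewrite s0.
      by rewrite mulr_ge0 ?exprn_ge0 ?ler0n // ltW.
    by rewrite add0r /log2 ln1 mul0r mulr0.
  move=> r0 ht; split=> [infK|finK].
    have [s /exists_minimum[s' [ms' les']] les] := rank_bound_infinite hd r0 infK ht.
    exists s'; split=> //; rewrite -natrX -natrM ler_nat.
    apply: leq_trans les' (leq_trans les _).
    by rewrite expnMn mulnA leq_mul // leq_pmull // muln_gt0 hd.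
  have [s /exists_minimum[s' [ms' les']] les] := rank_bound_finite hd r0 finK ht.
  exists s'; split=> //; apply: (@le_trans _ _ (12 * d * c * r ^ d.-1 * up_log 2 r.+1)%:R).
    rewrite ler_nat; apply: leq_trans les' (leq_trans les _).
    by rewrite expnMn mulnAC !mulnA.
  rewrite natrM (le_trans (ler_wpM2l _ (up_log_le_log2 R r0))) ?ler0n //.
  have lg0 : 0 <= log2 (r%:R + 1) :> R := @le_log2 R 0 r isT.
  rewrite mulrA ler_wpM2r //.
  by rewrite -natrX /C -!natrM ler_nat mulnC !mulnA.
rewrite !subn1; split.
  by exists C; split=> // K n t r [ht _]; apply: main.
(* The factor X + 1 dominates the logarithm for finite [K] and is at least 1 for infinite [K]. *)
exists (C *: ('X^(d.-1) * ('X + 1))) => K n t Kbar iota _ r [hr _].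
have [r' [[hr' _] ler']] := exists_minimum (border_partition_sum_map hr).
have [hinf hfin] := main K n t r' hr'.
have le1 : C * r'%:R ^+ d.-1 <= C * r%:R ^+ d.-1.
  apply: ler_wpM2l; first exact: ltW.
  rewrite -!natrX ler_nat.
  by case: (d.-1) => // k; rewrite leq_exp2r.
have Cr0 : 0 <= C * r%:R ^+ d.-1 by rewrite mulr_ge0 ?exprn_ge0 // ltW.
have -> : (C *: ('X^(d.-1) * ('X + 1))).[r%:R] = C * r%:R ^+ d.-1 * (r%:R + 1).
  by rewrite !hornerE.
have [/hfin|/hinf] := pselect (finite_set [set: K]%classic);
  move=> [s [hs les]]; exists s; split=> //; apply: le_trans les _.
  apply: ler_pM => //; [exact: mulr_ge0 (ltW C0) (exprn_ge0 _ (ler0n _ _)) | |].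
    exact: (@le_log2 R 0 r').
  by rewrite (le_trans (log2_le R r')) // natr1 ler_nat leqW.
by rewrite (le_trans le1) // ler_peMr // lerDr.
Qed.
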